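(* Let $0<p\le 1$ and let $(X,\|\cdot\|_p)$ be a finite-dimensional real complete $p$-normed space with $\dim X\ge 2$. Then for every $t\in[0,\tfrac12)$, $$L_p(t,X)=\frac{1}{2^{2p-1}}\,\gamma_p(1-2t,X).$$
   Context: A $p$-norm on a real vector space $X$ is a map $\|\cdot\|_p:X\to[0,\infty)$ such that (i) $\|x\|_p=0$ iff $x=0$; (ii) $\|\lambda x\|_p=|\lambda|^p\|x\|_p$ for all $\lambda\in\mathbb{R}$, $x\in X$; (iii) $\|x+y\|_p\le\|x\|_p+\|y\|_p$ for all $x,y\in X$. A (complete) $p$-normed space is a vector space with such a $p$-norm (complete for the metric $\|x-y\|_p$). $S_X=\{x\in X:\|x\|_p=1\}$. Elements $x,y\in X$ are isosceles orthogonal, written $x\perp_I y$, iff $\|x+y\|_p=\|x-y\|_p$. For $t\in[0,\tfrac12)$, $$L_p(t,X)=\sup\left\{\frac{\|tx+(1-t)y\|_p^2+\|(1-t)x+ty\|_p^2}{\|x+y\|_p^2}: x,y\in X,\ (x,y)\ne(0,0),\ x\perp_I y\right\}.$$ For $s\in[0,1]$, $$\gamma_p(s,X)=\sup\left\{\frac{\|x+sy\|_p^2+\|x-sy\|_p^2}{2}: x,y\in S_X\right\}.$$ *)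

(* Defs.v *)
From HB Require Import structures.
From mathcomp Require Import all_boot all_order all_algebra.
From mathcomp Require Import all_classical all_reals all_analysis.
From mathcomp Require Import lra.
Set Implicit Arguments.
Unset Strict Implicit.
Unset Printing Implicit Defensive.
Import Order.TTheory GRing.Theory Num.Theory.
Local Open Scope classical_set_scope.
Local Open Scope ring_scope.

Record pnorm (R : realType) (p : R) (X : lmodType R) := PNorm {
  pnorm_fun :> X -> R ;
  pnorm_ge0 : forall x, 0 <= pnorm_fun x ;
  pnorm_eq0 : forall x, pnorm_fun x = 0 <-> x = 0 ;
  pnormZ : forall (l : R) x, pnorm_fun (l *: x) = `|l| `^ p * pnorm_fun x ;
  pnormD : forall x y, pnorm_fun (x + y) <= pnorm_fun x + pnorm_fun y }.

(* A copy of [X] whose topology and uniformity come from the distance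
   [N (x - y)]. *)
Definition pnorm_space (R : realType) (p : R) (X : lmodType R) (N : pnorm p X)
  : Type := X.

Section pnorm_metric.
Context (R : realType) (p : R) (X : lmodType R) (N : pnorm p X).

Lemma pnorm0 : N 0 = 0.
Proof. exact/pnorm_eq0. Qed.

Lemma pnormN x : N (- x) = N x.
Proof. by rewrite -scaleN1r pnormZ normrN normr1 powR1 mul1r. Qed.

Lemma pnorm_distxx x : N (x - x) = 0.
Proof. by rewrite subrr pnorm0. Qed.

Lemma pnorm_dist_eq0 x y : N (x - y) = 0 -> x = y.
Proof. by move/pnorm_eq0/subr0_eq. Qed.

Lemma pnorm_distC x y : N (x - y) = N (y - x).
Proof. by rewrite -pnormN opprB. Qed.

Lemma pnorm_dist_triangle y x z : N (x - z) <= N (x - y) + N (y - z).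
Proof. by rewrite -{1}(subrK y x) -addrA; apply: pnormD. Qed.

HB.instance Definition _ := Choice.copy (pnorm_space N) X.
HB.instance Definition _ := isPointed.Build (pnorm_space N) (0 : X).
HB.instance Definition _ := isMetric.Build R (pnorm_space N)
  pnorm_distxx pnorm_dist_eq0 pnorm_distC pnorm_dist_triangle.

End pnorm_metric.

Section constants.
Context (R : realType) (p : R) (X : lmodType R) (N : pnorm p X).

Definition pnorm_complete : Prop :=
  forall F : set_system (pnorm_space N), ProperFilter F -> cauchy F -> cvg F.

Definition pnorm_sphere : set X := [set x | N x = 1].

Definition isosceles_orthogonal (x y : X) : Prop := N (x + y) = N (x - y).

Definition Lp_set (t : R) : set R :=
  [set r | exists x y : X,
     [/\ (x, y) <> (0, 0), isosceles_orthogonal x y &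
         r = (N (t *: x + (1 - t) *: y) ^+ 2 + N ((1 - t) *: x + t *: y) ^+ 2)
             / N (x + y) ^+ 2] ].

Definition gammap_set (s : R) : set R :=
  [set r | exists x y : X,
     [/\ pnorm_sphere x, pnorm_sphere y &
         r = (N (x + s *: y) ^+ 2 + N (x - s *: y) ^+ 2) / 2] ].

(* On a nonzero space with [0 < p], these suprema are genuine for
   [0 <= t <= 1] and [0 <= s <= 1]: see [has_sup_Lp] and [has_sup_gammap]. *)
Definition Lp (t : R) : R := sup (Lp_set t).

Definition gammap (s : R) : R := sup (gammap_set s).

Hypothesis p_gt0 : 0 < p.

Lemma pnormZ_le (l : R) x : `|l| <= 1 -> N (l *: x) <= N x.
Proof.
move=> l1; rewrite pnormZ ler_piMl ?pnorm_ge0//.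
have -> : 1 = 1 `^ p :> R by rewrite powR1.
apply: ge0_ler_powR => //; rewrite ?nnegrE//.
exact: ltW.
Qed.

Lemma isosceles_orthogonal_le x y : isosceles_orthogonal x y ->
  N x <= 2 * N (x + y) /\ N y <= 2 * N (x + y).
Proof.
have h : `|2^-1 : R| <= 1 by rewrite ger0_norm; lra.
have half (z : X) : 2^-1 *: (z + z) = z.
  by rewrite scalerDr -scalerDl [_ + _](_ : _ = 1) ?scale1r//; lra.
move=> xy; split.
- have e : (x + y) + (x - y) = x + x by rewrite addrACA subrr addr0.
  rewrite -{1}(half x) -e.
  have := le_trans (pnormZ_le _ h) (pnormD N (x + y) (x - y)).
  by rewrite -xy -[X in _ <= X -> _]mulr2n mulr_natl.
- have e : (x + y) + (- (x - y)) = y + y.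
    by rewrite opprB addrC addrA subrK.
  rewrite -{1}(half y) -e.
  have := le_trans (pnormZ_le _ h) (pnormD N (x + y) (- (x - y))).
  by rewrite pnormN -xy -[X in _ <= X -> _]mulr2n mulr_natl.
Qed.

Lemma has_sup_Lp (v : X) (t : R) : v <> 0 -> 0 <= t <= 1 -> has_sup (Lp_set t).
Proof.
move=> v0 /andP[t0 t1]; split.
  eexists; exists v, 0; split; last reflexivity.
    by case.
  by rewrite /isosceles_orthogonal subr0 addr0.
have a1 : `|t| <= 1 by rewrite ger0_norm.
have b1 : `|1 - t| <= 1 by rewrite ger0_norm; lra.
exists 32 => _ [x [y [xy0 xy ->]]].
have [hx hy] := isosceles_orthogonal_le xy.
have N0 : 0 < N (x + y).
  rewrite lt_neqAle pnorm_ge0 andbT eq_sym; apply/eqP => e; apply: xy0.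
  move: hx hy; rewrite e mulr0 => hx hy.
  by congr pair; apply/(pnorm_eq0 N)/eqP; rewrite eq_le pnorm_ge0 andbT.
have H a b : `|a| <= 1 -> `|b| <= 1 ->
    N (a *: x + b *: y) ^+ 2 <= 16 * N (x + y) ^+ 2.
  move=> ha hb; have : N (a *: x + b *: y) <= 4 * N (x + y).
    have := pnormD N (a *: x) (b *: y).
    have := pnormZ_le x ha; have := pnormZ_le y hb; lra.
  by have := pnorm_ge0 N (a *: x + b *: y); nra.
rewrite ler_pdivrMr ?exprn_gt0//.
by have := H _ _ a1 b1; have := H _ _ b1 a1; lra.
Qed.

Lemma has_sup_gammap (v : X) (s : R) :
  v <> 0 -> 0 <= s <= 1 -> has_sup (gammap_set s).
Proof.
move=> v0 /andP[s0 s1]; split.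
  have Nv : N v != 0 by apply/eqP => /pnorm_eq0.
  have Su : pnorm_sphere ((N v)^-1 `^ p^-1 *: v).
    rewrite /pnorm_sphere /= pnormZ ger0_norm ?powR_ge0// -powRrM.
    by rewrite mulVf ?gt_eqF// powRr1 ?invr_ge0 ?pnorm_ge0// mulVf.
  by eexists; do 2 eexists; split; [exact: Su|exact: Su|reflexivity].
exists 4 => _ [x [y [x1 y1 ->]]].
have h : `|s| <= 1 by rewrite ger0_norm.
have Nsy : N (s *: y) <= 1 by rewrite -y1; exact: pnormZ_le.
have := pnormD N x (s *: y); have := pnormD N x (- (s *: y)).
rewrite pnormN x1.
have := pnorm_ge0 N (x + s *: y); have := pnorm_ge0 N (x - s *: y); nra.
Qed.

End constants.

(* Main.v *)
Require Import Defs.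
From mathcomp Require Import all_boot all_order all_algebra.
From mathcomp Require Import all_classical all_reals all_analysis.
From mathcomp Require Import ring lra.
Import Order.TTheory GRing.Theory Num.Theory.
Local Open Scope ring_scope.

(** Put [u = x + y] and [v = x - y].  Isosceles orthogonality of [x] and [y]
    says exactly that [u] and [v] have the same norm, and with [s = 1 - 2 t]
    the two vectors in the numerator of [Lp_set] become [2^-1 *: (u - s *: v)]
    and [2^-1 *: (u + s *: v)].  Homogeneity pulls [2^-1] out of the squared
    norms as [2 `^ (- 2 p)], and it also allows [u] and [v] to be rescaled by
    one common factor so that both lie on the unit sphere, since the quotient
    by [N u ^+ 2] is invariant under such a rescaling.  Hence the set defining
    [L_p] is the dilation by [2 `^ (1 - 2 p)] of the set defining [gamma_p]
    ([Lp_setE]), and so are the suprema. *)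

Lemma sup_pZl (R : realType) (c : R) (A : set R) :
  0 < c -> has_sup A -> sup [set c * x | x in A]%classic = c * sup A.
Proof.
move=> c0 [A0 ubA]; have [a Aa] := A0.
have ub : ubound [set c * x | x in A]%classic (c * sup A).
  by move=> _ [x Ax <-]; rewrite ler_pM2l//; exact: ub_le_sup.
apply/eqP; rewrite eq_le; apply/andP; split.
  by apply: ge_sup => //; exists (c * a), a.
rewrite mulrC -ler_pdivlMr//; apply: ge_sup => // x Ax.
by rewrite ler_pdivlMr// mulrC; apply: ub_le_sup; [exists (c * sup A)|exists x].
Qed.

Section change_of_variables.
Context (R : realType) (p : R) (X : lmodType R) (N : pnorm p X).

Lemma half_add_sub (x y : X) : 2^-1 *: ((x + y) + (x - y)) = x.
Proof.
by rewrite addrACA subrr addr0 -mulr2n -(scaler_nat 2 x) scalerA mulVf ?scale1r.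
Qed.

Lemma combination_add_sub (a b : R) (x y : X) :
  (a + b) *: x + (a - b) *: y = a *: (x + y) + b *: (x - y).
Proof. by rewrite !scalerDl !scalerDr scaleNr scalerN addrACA. Qed.

Lemma pnorm_half (x : X) : N (2^-1 *: x) = (2 `^ p)^-1 * N x.
Proof.
rewrite pnormZ gtr0_norm ?invr_gt0//.
by rewrite -[in LHS]powR_inv1// -powRrM mulN1r powRN.
Qed.

Lemma Lp_quotientE (x y : X) (t : R) :
  (N (t *: x + (1 - t) *: y) ^+ 2 + N ((1 - t) *: x + t *: y) ^+ 2)
    / N (x + y) ^+ 2 =
  (2 `^ p)^-1 ^+ 2 * (N ((x + y) + (1 - 2 * t) *: (x - y)) ^+ 2
    + N ((x + y) - (1 - 2 * t) *: (x - y)) ^+ 2) / N (x + y) ^+ 2.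
Proof.
have -> : t *: x + (1 - t) *: y =
    2^-1 *: ((x + y) - (1 - 2 * t) *: (x - y)).
  rewrite (scalerBr 2^-1 (x + y)) scalerA -scaleNr -combination_add_sub.
  by congr (_ *: _ + _ *: _); field.
have -> : (1 - t) *: x + t *: y =
    2^-1 *: ((x + y) + (1 - 2 * t) *: (x - y)).
  rewrite (scalerDr 2^-1 (x + y)) scalerA -combination_add_sub.
  by congr (_ *: _ + _ *: _); field.
by rewrite !pnorm_half !exprMn -mulrDr [X in _ * X / _]addrC.
Qed.

Lemma pnorm_gt0 (x : X) : x <> 0 -> 0 < N x.
Proof.
move=> x0; rewrite lt_neqAle pnorm_ge0 andbT eq_sym.
by apply/eqP => /(pnorm_eq0 N).
Qed.

(** Orthogonality makes [x + y] and [x - y] vanish together, which forces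
    [x = y = 0]; so the denominator in [Lp_set] is positive. *)
Lemma isosceles_orthogonal_add_neq0 (x y : X) :
  (x, y) <> (0, 0) -> isosceles_orthogonal N x y -> x + y <> 0.
Proof.
move=> xy0 xy xDy; apply: xy0.
have xBy : x - y = 0 by apply/(pnorm_eq0 N); rewrite -xy xDy pnorm0.
have x0 : x = 0 by rewrite -(half_add_sub x y) xDy xBy addr0 scaler0.
by move: xDy; rewrite x0 add0r => ->.
Qed.

Hypothesis p_gt0 : 0 < p.

Definition normalizer (x : X) : R := (N x)^-1 `^ p^-1.

Lemma pnorm_normalizer (x y : X) : N (normalizer x *: y) = N y / N x.
Proof.
rewrite pnormZ ger0_norm ?powR_ge0// -powRrM mulVf ?gt_eqF//.
by rewrite powRr1 ?invr_ge0 ?pnorm_ge0// mulrC.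
Qed.

Lemma Lp_setE (t : R) :
  Lp_set N t =
  [set 1 / 2 `^ (2 * p - 1) * r | r in gammap_set N (1 - 2 * t)]%classic.
Proof.
have two0 : 2 `^ p != 0 :> R by rewrite gt_eqF// powR_gt0.
have -> : 1 / 2 `^ (2 * p - 1) = 2 * (2 `^ p)^-1 ^+ 2 :> R.
  rewrite powRB ?pnatr_eq0 ?implybT// powRr1// [2 * p]mulrC powRrM powR_mulrn ?powR_ge0//.
  by field.
apply/seteqP; split => [_ [x [y [xy0 xy ->]]]|_ [_ [u [v [Nu Nv ->]]] <-]].
  have Nxy := pnorm_gt0 _ (isosceles_orthogonal_add_neq0 _ _ xy0 xy).
  set l := normalizer (x + y).
  eexists.
    exists (l *: (x + y)), (l *: (x - y)); split; last reflexivity.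
      by rewrite /pnorm_sphere /= pnorm_normalizer divff ?gt_eqF.
    by rewrite /pnorm_sphere /= pnorm_normalizer -xy divff ?gt_eqF.
  rewrite Lp_quotientE scalerA mulrC -[_ * l]mulrC -scalerA.
  rewrite -scalerBr -scalerDr !pnorm_normalizer.
  by field; rewrite two0 gt_eqF.
(* the pair with sum [u] and difference [v] *)
have sum : 2^-1 *: (u + v) + 2^-1 *: (u - v) = u.
  by rewrite -scalerDr half_add_sub.
have diff : 2^-1 *: (u + v) - 2^-1 *: (u - v) = v.
  by rewrite -scalerBr opprB [u + v]addrC half_add_sub.
exists (2^-1 *: (u + v)), (2^-1 *: (u - v)); split.
- move=> [x0 y0]; have : N u = 0 by rewrite -sum x0 y0 addr0 pnorm0.
  by rewrite Nu; apply/eqP; rewrite oner_eq0.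
- by rewrite /isosceles_orthogonal sum diff Nu Nv.
- by rewrite Lp_quotientE sum diff Nu; field.
Qed.

End change_of_variables.

Theorem theorem3p2 (R : realType) (p : R) (hp : 0 < p <= 1)
    (X : vectType R) (N : pnorm p X) (hN : pnorm_complete N)
    (hdim : (2 <= \dim {:X})%N) (t : R) (ht : 0 <= t < 1 / 2) :
  Lp N t = 1 / 2 `^ (2 * p - 1) * gammap N (1 - 2 * t).
Proof.
have /andP[p0 _] := hp; have /andP[t0 t2] := ht.
rewrite /Lp Lp_setE// sup_pZl// ?divr_gt0 ?powR_gt0//.
apply: (@has_sup_gammap _ _ _ _ p0 (vpick {:X})); last by apply/andP; split; lra.
by move/eqP; rewrite vpick0 -dimv_eq0 => /eqP d0; move: hdim; rewrite d0.
Qed.
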